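(* Let $\mathcal H$ be a Hilbert space of finite dimension $d$ and $\mathcal K$ a finite-dimensional Hilbert space. Let $\{|e_s\rangle\}_{s=0}^{d-1}$ be an orthonormal basis of $\mathcal H$, $\{\lambda_s\}_{s=0}^{d-1}$ a probability distribution, $V=\sum_{s=0}^{d-1}\exp\!\left(i\frac{2\pi s}{d}\right)|e_s\rangle\langle e_s|$, and $\Phi(\sigma)=\sum_{j=0}^{d-1}\lambda_jV^j\sigma V^{*j}$ the corresponding phase damping channel on $\mathfrak S(\mathcal H)$. Let $\mathcal A$ be the set of states on $\mathcal H$ that can be written as convex combinations of pure states $|f\rangle\langle f|$ with $|\langle f|e_s\rangle|=\frac1{\sqrt d}$ for all $s$. Suppose $\rho\in\mathfrak S(\mathcal H\otimes\mathcal K)$ satisfies $\mathrm{Tr}_{\mathcal K}(\rho)\in\mathcal A$. Then for every quantum channel $\Omega:\mathfrak S(\mathcal K)\to\mathfrak S(\mathcal K)$, $$S((\Phi\otimes\Omega)(\rho))\ge-\sum_{j=0}^{d-1}\lambda_j\log\lambda_j+H_\Omega(\mathrm{Tr}_{\mathcal H}(\rho))\ge H_\Phi(\mathrm{Tr}_{\mathcal K}(\rho))+H_\Omega(\mathrm{Tr}_{\mathcal H}(\rho)).$$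
   Context: $\mathfrak S(\cdot)$ denotes the set of density operators; a quantum channel is a completely positive trace-preserving linear map; $S(\sigma)=-\mathrm{Tr}(\sigma\log\sigma)$ is the von Neumann entropy. For a channel $\Psi$ with input space $\mathcal L$ and $\sigma\in\mathfrak S(\mathcal L)$, $H_\Psi(\sigma):=\min\sum_{j}\pi_jS(\Psi(\sigma_j))$, the minimum over all finite decompositions $\sigma=\sum_j\pi_j\sigma_j$ with $\{\pi_j\}$ a probability distribution and $\sigma_j\in\mathfrak S(\mathcal L)$. *)

(* Defs.v *)
From HB Require Import structures.
From mathcomp Require Import all_boot all_order all_algebra.
From mathcomp Require Import sesquilinear spectral.
From mathcomp Require Import complex.
From mathcomp Require Import classical_sets boolp reals exp trigo.

Set Implicit Arguments.
Unset Strict Implicit.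
Unset Printing Implicit Defensive.

Import Order.TTheory GRing.Theory Num.Theory Num.Def.
Local Open Scope ring_scope.
Local Open Scope classical_set_scope.

Section QuantumDefs.
Variable R : realType.
Local Notation C := (R[i]).

Definition adj {p q} (A : 'M[C]_(p, q)) : 'M[C]_(q, p) := (map_mx conjC A)^T.

(* positive semidefinite: <x, A x> >= 0 for all x (over C this implies
   Hermitian; 0 <= z in C means z real and nonnegative) *)
Definition psd {n} (A : 'M[C]_n) : Prop :=
  forall x : 'cV[C]_n, 0 <= (adj x *m A *m x) 0 0.

Definition is_state {n} (A : 'M[C]_n) : Prop := psd A /\ \tr A = 1.

Definition xlogx (t : R) : R := if t == 0 then 0 else t * ln t.

(* von Neumann entropy S(s) = - Tr (s log s) = - sum_i mu_i log mu_i where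
   mu_i are the eigenvalues of s (the diagonal of its Schur/spectral form). *)
Definition vN_entropy {n} (s : 'M[C]_n) : R :=
  - \sum_(i < n) xlogx (complex.Re (spectral_diag s 0 i)).

Definition shannon {n} (p : 'I_n -> R) : R := - \sum_(i < n) xlogx (p i).

Definition kron {d m} (A : 'M[C]_d) (B : 'M[C]_m) : 'M[C]_(d * m) :=
  \sum_(i < d) \sum_(j < d) \sum_(k < m) \sum_(l < m)
     (A i j * B k l) *: delta_mx (mxvec_index i k) (mxvec_index j l).

Definition tensmap {d m} (F : 'M[C]_d -> 'M[C]_d) (G : 'M[C]_m -> 'M[C]_m)
  (X : 'M[C]_(d * m)) : 'M[C]_(d * m) :=
  \sum_(i < d) \sum_(j < d) \sum_(k < m) \sum_(l < m)
     X (mxvec_index i k) (mxvec_index j l) *: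
       kron (F (delta_mx i j)) (G (delta_mx k l)).

Definition ptrace2 {d m} (X : 'M[C]_(d * m)) : 'M[C]_d :=
  \matrix_(i, j) \sum_(k < m) X (mxvec_index i k) (mxvec_index j k).
Definition ptrace1 {d m} (X : 'M[C]_(d * m)) : 'M[C]_m :=
  \matrix_(k, l) \sum_(i < d) X (mxvec_index i k) (mxvec_index i l).

Definition is_channel {m} (Om : 'M[C]_m -> 'M[C]_m) : Prop :=
  linear Om /\
  (forall (n : nat) (X : 'M[C]_(n * m)), psd X -> psd (tensmap id Om X)) /\
  (forall X, \tr (Om X) = \tr X).

(* H_Psi(s) = min over finite ensembles of sum_j pi_j S(Psi(s_j));
   written as an infimum (the minimum is attained). *)
Definition Hmin {n} (Psi : 'M[C]_n -> 'M[C]_n) (s : 'M[C]_n) : R :=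
  inf [set x : R | exists (k : nat) (p : 'I_k -> R) (t : 'I_k -> 'M[C]_n),
     [/\ (forall j, 0 <= p j), \sum_(j < k) p j = 1,
         (forall j, is_state (t j)),
         s = \sum_(j < k) (Complex (p j) 0) *: t j &
         x = \sum_(j < k) p j * vN_entropy (Psi (t j))]].

Definition orthonormal_family {d} (e : 'I_d -> 'cV[C]_d) : Prop :=
  forall s t, (adj (e s) *m e t) 0 0 = (s == t)%:R.

Definition cexp (t : R) : C := Complex (cos t) (sin t).

Definition phaseV {d} (e : 'I_d -> 'cV[C]_d) : 'M[C]_d :=
  \sum_(s < d) cexp (2 * pi * s%:R / d%:R) *: (e s *m adj (e s)).

Definition phase_damping {d} (e : 'I_d -> 'cV[C]_d) (lam : 'I_d -> R)
  (s : 'M[C]_d) : 'M[C]_d :=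
  \sum_(j < d) Complex (lam j) 0 *:
     ((phaseV e) ^+ j *m s *m (adj (phaseV e)) ^+ j).

Definition setA {d} (e : 'I_d -> 'cV[C]_d) (s : 'M[C]_d) : Prop :=
  exists (k : nat) (p : 'I_k -> R) (f : 'I_k -> 'cV[C]_d),
    [/\ (forall j, 0 <= p j), \sum_(j < k) p j = 1,
        (forall j, (adj (f j) *m f j) 0 0 = 1),
        (forall j t, `|(adj (f j) *m e t) 0 0| = Complex (Num.sqrt (d%:R : R))^-1 0) &
        s = \sum_(j < k) Complex (p j) 0 *: (f j *m adj (f j))].

End QuantumDefs.

(* Main.v *)
(* Let [s = (id (x) Om) rho], [s_j = V^j s V^-j], [A = sum_j lam_j s_j] (the
   output state) and [B = (1/d) sum_j s_j].  The state [B] is the pinching of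
   [s] (and of [A]) by the measurement of the basis [e], whose outcomes are
   uniform because the first marginal of [rho] lies in [setA e]; so
   [S B = log d + avg_s S (Om tau_s)] for the conditional states [tau_s], which
   average to the second marginal of [rho].  Since [D (A || B) = S B - S A], the
   first inequality follows from [D (A || B) <= D (lam || 1/d) = log d - H lam],
   the joint convexity of the relative entropy for mixtures of the same states.
   This is proved through parallel sums: the quadratic form
   [tr (Y^* A Y) + t tr ((1 - Y) B (1 - Y)^* )] is additive in [(A, B)] and its
   minimum over [Y] is the parallel sum of [A] and [t B], which is therefore
   superadditive for every [t > 0]; integrating the resulting rational
   inequality over [t] produces the logarithms.
   The second inequality holds because the channel sends a flat pure state to
   a state with spectrum [lam]. *)

Require Import Defs.
From HB Require Import structures.
From mathcomp Require Import all_boot all_order all_algebra.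
From mathcomp Require Import sesquilinear spectral complex.
From mathcomp Require Import classical_sets boolp reals exp trigo.
From mathcomp Require Import functions topology normedtype derive realfun.
From mathcomp Require Import ring lra.
Set Implicit Arguments.
Unset Strict Implicit.
Unset Printing Implicit Defensive.
Import Order.TTheory GRing.Theory Num.Theory Num.Def numFieldNormedType.Exports.
Local Open Scope ring_scope.

Local Notation "r %:C" := (real_complex _ r) : ring_scope.

(** * Classical entropy inequalities *)

Lemma is_derive1_bigsum (R : realType) (I : Type) (r : seq I) (P : pred I)
    (h : I -> R -> R) (dh : I -> R) (x : R) :
  (forall i, P i -> is_derive x 1 (h i) (dh i)) ->
  is_derive x 1 (fun y => \sum_(i <- r | P i) h i y) (\sum_(i <- r | P i) dh i).
Proof.
move=> hh; rewrite (_ : (fun y => _) = \sum_(i <- r | P i) h i).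
  by elim/big_ind2 : _ => // [|*]; [exact: is_derive_cst|exact: is_deriveD].
by apply/funext => y; rewrite fct_sumE.
Qed.

(** Used to bound the errors near both ends of the integration range below: they are at most linear
    in the cutoff. *)
Lemma ln1D_bounds (R : realType) (x : R) : 0 <= x -> 0 <= ln (1 + x) <= x.
Proof.
move=> x0; rewrite ln_ge0 ?lerDl//= le_ln1Dx//.
by apply: lt_le_trans x0; rewrite oppr_lt0.
Qed.

Lemma ler_sum_norm1 (R : realDomainType) (I : finType) (P : pred I)
    (c x y : I -> R) : (forall i, P i -> 0 <= x i <= y i) ->
  `|\sum_(i | P i) c i * x i| <= \sum_(i | P i) `|c i| * y i.
Proof.
move=> xy; apply: (le_trans (ler_norm_sum _ _ _)); apply: ler_sum => i Pi.
have /andP[x0 xyi] := xy _ Pi.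
by rewrite normrM (ger0_norm x0) ler_wpM2l.
Qed.

(* Integrating the hypothesis over [0 < t < oo]: the divergent parts cancel
   because the coefficients sum to zero. *)
Lemma sum_ln_le0 (R : realType) (I : finType) (P : pred I) (c r : I -> R) :
  (forall i, P i -> 0 < r i) -> \sum_(i | P i) c i = 0 ->
  (forall t : R, 0 < t -> 0 <= \sum_(i | P i) c i / (r i + t)) ->
  \sum_(i | P i) c i * ln (r i) <= 0.
Proof.
move=> r0 c0 ct.
(* An antiderivative of the rational function in the hypothesis, hence nondecreasing on [t > 0]. It
   tends to the target sum as [t] goes to 0 and to 0 at infinity. *)
pose f (t : R) := \sum_(i | P i) c i * ln (r i + t).
have fder (t : R) : 0 < t -> is_derive t 1 f (\sum_(i | P i) c i / (r i + t)).
  move=> t0; apply: is_derive1_bigsum => i Pi.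
  have rt : 0 < r i + t by rewrite addr_gt0 ?r0.
  have H1 : is_derive t 1 (fun t : R => r i + t) 1.
    by rewrite -[X in is_derive _ _ _ X]add0r; apply: is_deriveD.
  have H2 := @is_derive1_comp _ (@ln R) (fun t : R => r i + t) t _ _ (is_derive1_ln rt) H1.
  rewrite mulr1 in H2.
  exact: (@is_deriveZ _ _ _ _ (c i) _ _ _ H2).
have fmono (s t : R) : 0 < s -> s <= t -> f s <= f t.
  move=> s0 st; apply: (@ger0_derive1_ndecr _ f s t) => //.
  - move=> x; rewrite in_itv /= => /andP[sx _].
    by have [] := fder x (lt_trans s0 sx).
  - move=> x; rewrite in_itv /= => /andP[sx _].
    have x0 := lt_trans s0 sx.
    by rewrite derive1E (@derive_val _ _ _ _ _ _ _ (fder x x0)); apply: ct.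
  - apply: derivable_within_continuous => x; rewrite in_itv /= => /andP[sx _].
    by have [] := fder x (lt_le_trans s0 sx).
set S := \sum_(i | P i) c i * ln (r i).
pose M := \sum_(i | P i) `|c i| / r i + \sum_(i | P i) `|c i| * r i.
have low (s : R) : 0 < s -> S - f s <= s * (\sum_(i | P i) `|c i| / r i).
  move=> s0; rewrite -opprB; apply: le_trans (ler_norm _) _; rewrite normrN.
  have -> : f s - S = \sum_(i | P i) c i * ln (1 + s / r i).
    rewrite -sumrB; apply: eq_bigr => i Pi.
    rewrite -mulrBr -ln_div ?posrE ?addr_gt0 ?r0//; congr (_ * ln _).
    by rewrite mulrDl mulfV ?gt_eqF ?r0.
  apply: le_trans (@ler_sum_norm1 _ _ _ _ _ (fun i => s / r i) _) _ => [i Pi|].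
    by apply: ln1D_bounds; rewrite divr_ge0 ?ltW ?r0.
  rewrite mulr_sumr le_eqVlt; apply/orP; left; apply/eqP.
  by apply: eq_bigr => i _; rewrite mulrCA.
(* At the far end [1 / s], each logarithm splits as [ln (1 + s * r i) - ln s], and the divergent
   [ln s] is killed by [c0]. *)
have up (s : R) : 0 < s -> f s^-1 <= s * \sum_(i | P i) `|c i| * r i.
  move=> s0; apply: le_trans (ler_norm _) _.
  have -> : f s^-1 = \sum_(i | P i) c i * ln (1 + s * r i).
    transitivity (\sum_(i | P i) c i * ln (1 + s * r i) - (\sum_(i | P i) c i) * ln s).
      rewrite mulr_suml -sumrB; apply: eq_bigr => i Pi.
      have sr : 0 < 1 + s * r i by rewrite addr_gt0// mulr_gt0 ?r0.
      rewrite -mulrBr -ln_div ?posrE//; congr (_ * ln _).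
      by rewrite mulrDl mulrAC mulfV ?gt_eqF// !mul1r addrC.
    by rewrite c0 mul0r subr0.
  apply: le_trans (@ler_sum_norm1 _ _ _ _ _ (fun i => s * r i) _) _ => [i Pi|].
    by apply: ln1D_bounds; rewrite mulr_ge0 ?ltW ?r0.
  rewrite mulr_sumr le_eqVlt; apply/orP; left; apply/eqP.
  by apply: eq_bigr => i _; rewrite mulrCA.
(* For [s <= 1] one has [s <= 1 / s], so monotonicity of [f] links the two end estimates. *)
have SM (s : R) : 0 < s -> s <= 1 -> S <= s * M.
  move=> s0 s1; rewrite /M mulrDr -lerBlDr; apply: le_trans _ (low _ s0).
  rewrite lerD2l lerN2; apply: le_trans _ (up _ s0); apply: fmono => //.
  by apply: (le_trans s1); rewrite invf_ge1.
have M0 : 0 <= M.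
  by rewrite addr_ge0// sumr_ge0// => i Pi; rewrite mulr_ge0// ?invr_ge0 ltW ?r0.
apply/ler_addgt0Pr => e e0.
(* The cutoff [e / (M + e + 1)] is at most 1, and its product with [M] is at most [e]. *)
have m0 : 0 < M + e + 1 by lra.
apply: le_trans (SM (e / (M + e + 1)) _ _) _.
- exact: divr_gt0.
- by rewrite ler_pdivrMr//; lra.
- by rewrite add0r mulrAC ler_pdivrMr// ler_wpM2l ?ltW//; lra.
Qed.

Lemma xlogxM_ln (R : realType) (a : R) : xlogx a = a * ln a.
Proof. by rewrite /xlogx; case: eqP => // ->; rewrite mul0r. Qed.

(** Wherever the joint mass is nonzero both logarithms have positive arguments; the remaining terms
    vanish whatever value [ln] takes there. *)
Lemma kernel_support (R : realType) (I L : finType)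
    (a : I -> R) (b : L -> R) (w : I -> L -> R) :
  (forall i, 0 <= a i) -> (forall i l, 0 <= w i l) ->
  (forall l, \sum_i a i * w i l = b l) ->
  forall i l, w i l * a i != 0 -> 0 < a i /\ 0 < b l.
Proof.
move=> a0 w0 ab i l h.
have aw : 0 < a i * w i l by rewrite mulrC lt0r h mulr_ge0.
have ai : 0 < a i.
  by rewrite lt0r a0 andbT; apply: contraNneq h => ->; rewrite mulr0.
split=> //; rewrite -ab (bigD1 i)//= ltr_pwDl// sumr_ge0// => k _.
exact: mulr_ge0.
Qed.

(** Both sums are integrals against the joint mass [w i l * a i], whose marginals are [a] and [b];
    the difference then takes the form of a relative entropy. *)
Lemma xlogx_kernel_diff (R : realType) (I L : finType)
    (a : I -> R) (b : L -> R) (w : I -> L -> R) :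
  (forall i, \sum_l w i l = 1) -> (forall l, \sum_i a i * w i l = b l) ->
  \sum_i xlogx (a i) - \sum_l xlogx (b l)
    = \sum_i \sum_l (w i l * a i * ln (a i) - w i l * a i * ln (b l)).
Proof.
move=> w1 ab; rewrite (eq_bigr _ (fun i _ => sumrB _ _ _ _)) sumrB; congr (_ - _).
  by apply: eq_bigr => i _; rewrite -!mulr_suml w1 mul1r xlogxM_ln.
rewrite exchange_big; apply: eq_bigr => l _; rewrite -mulr_suml xlogxM_ln -ab.
by congr (_ * _); apply: eq_bigr => i _; rewrite mulrC.
Qed.

(* The hypothesis compares the parallel sums [a : t b]; it is the
   resolvent form of [D(a, b) <= D(lam, mu)]. *)
Lemma relative_entropy_le (R : realType) (I L J : finType)
    (a : I -> R) (b : L -> R) (w : I -> L -> R) (lam mu : J -> R) :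
  (forall i, 0 <= a i) -> (forall i l, 0 <= w i l) ->
  (forall i, \sum_l w i l = 1) -> (forall l, \sum_i a i * w i l = b l) ->
  (forall j, 0 <= lam j) -> (forall j, 0 < mu j) ->
  \sum_i a i = \sum_j lam j ->
  (forall t : R, 0 < t -> \sum_j lam j * mu j / (lam j + t * mu j)
      <= \sum_i \sum_l w i l * (a i * b l / (a i + t * b l))) ->
  \sum_i xlogx (a i) - \sum_l xlogx (b l)
    <= \sum_j xlogx (lam j) - \sum_j lam j * ln (mu j).
Proof.
move=> a0 w0 w1 ab lam0 mu0 alam H.
(* Both relative entropies become one signed sum of [c * ln r]: the quantum side has positive mass
   and the classical side negative mass, so that [sum_ln_le0] gives the comparison. *)
pose c (x : I * L + J) := match x with
  | inl (i, l) => w i l * a i | inr j => - lam j end.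
pose r (x : I * L + J) := match x with
  | inl (i, l) => a i / b l | inr j => lam j / mu j end.
have waP := kernel_support a0 w0 ab.
(* Restricting to the support of [c] keeps every ratio [r] positive, without changing the sums. *)
have sumc0 (F : I * L + J -> R) :
    \sum_(x | c x != 0) c x * F x = \sum_x c x * F x.
  rewrite [RHS](bigID (fun x => c x != 0))/= [X in _ + X]big1 ?addr0//.
  by move=> x /negbNE/eqP->; rewrite mul0r.
have split_sum (F : I * L + J -> R) : \sum_x c x * F x =
   \sum_i \sum_l w i l * a i * F (inl (i, l)) - \sum_j lam j * F (inr j).
  rewrite big_sumType/= pair_big/= -sumrN.
  by congr (_ + _); apply: eq_bigr => k _ //=; [case: k|rewrite mulNr].
have := @sum_ln_le0 R _ (fun x => c x != 0) c r _ _ _.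
rewrite sumc0 split_sum.
have -> : \sum_i \sum_l w i l * a i * ln (r (inl (i, l)))
   = \sum_i xlogx (a i) - \sum_l xlogx (b l).
  rewrite (xlogx_kernel_diff w1 ab); apply: eq_bigr => i _; apply: eq_bigr => l _.
  rewrite -mulrBr.
  have [->|/waP[ai bl]] := eqVneq (w i l * a i) 0; first by rewrite !mul0r.
  by rewrite /= ln_div.
have -> : \sum_j lam j * ln (r (inr j)) = \sum_j xlogx (lam j) - \sum_j lam j * ln (mu j).
  rewrite -sumrB; apply: eq_bigr => j _; rewrite /= xlogxM_ln.
  have [->|lj] := eqVneq (lam j) 0; first by rewrite !mul0r subrr.
  by rewrite ln_div ?posrE ?mu0// ?lt0r ?lj ?lam0// mulrBr.
rewrite subr_le0; apply.
- case=> [[i l]/waP[ai bl]|j]/=; first exact: divr_gt0.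
  by rewrite oppr_eq0 => lj; rewrite divr_gt0// lt0r lj lam0.
- under eq_bigr do rewrite -[c _]mulr1.
  rewrite sumc0 split_sum; apply/eqP; rewrite subr_eq0; apply/eqP.
  under [RHS]eq_bigr do rewrite mulr1.
  rewrite -alam; apply: eq_bigr => i _.
  by under eq_bigr do rewrite mulr1; rewrite -mulr_suml w1 mul1r.
- move=> t t0; rewrite sumc0 split_sum subr_ge0.
  (* Clearing the inner fraction turns [lam / (lam / mu + t)] into a parallel sum; the same is done
     for the pairs below. *)
  rewrite [leLHS](_ : _ = \sum_j lam j * mu j / (lam j + t * mu j)); last first.
    apply: eq_bigr => j _ /=.
    have muj := mu0 j; have lt : 0 < lam j + t * mu j by rewrite ltr_wpDl ?mulr_gt0.
    by field; rewrite !gt_eqF.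
  rewrite [leRHS](_ : _ = \sum_i \sum_l w i l * (a i * b l / (a i + t * b l))); first exact: H.
  apply: eq_bigr => i _; apply: eq_bigr => l _ /=.
  have [h|/waP[ai bl]] := eqVneq (w i l * a i) 0; first by rewrite !mulrA h !mul0r.
  have lt : 0 < a i + t * b l by rewrite addr_gt0 ?mulr_gt0.
  by field; rewrite !gt_eqF.
Qed.

(** A doubly stochastic kernel raises entropy. This is Gibbs' inequality, obtained termwise from
    [ln u <= u - 1]. *)
Lemma sum_xlogx_mix_le (R : realType) (I L : finType)
    (a : I -> R) (b : L -> R) (w : I -> L -> R) :
  (forall i, 0 <= a i) -> (forall i l, 0 <= w i l) ->
  (forall i, \sum_l w i l = 1) -> (forall l, \sum_i w i l = 1) ->
  (forall l, \sum_i a i * w i l = b l) ->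
  \sum_l xlogx (b l) <= \sum_i xlogx (a i).
Proof.
move=> a0 w0 w1 w1' ab; rewrite -subr_ge0.
have waP := kernel_support a0 w0 ab.
have b0 l : 0 <= b l by rewrite -ab sumr_ge0// => i _; rewrite mulr_ge0.
rewrite (xlogx_kernel_diff w1 ab).
(* Zero is written as a double sum, by double stochasticity, so that the comparison can be made term
   by term. *)
rewrite [leLHS](_ : _ = \sum_i \sum_l (w i l * a i - w i l * b l)); last first.
  apply/esym; rewrite exchange_big/= big1// => l _; rewrite sumrB -[X in _ - X]mulr_suml w1' mul1r.
  by apply/eqP; rewrite subr_eq0 -ab; apply/eqP; apply: eq_bigr => i _; rewrite mulrC.
apply: ler_sum => i _; apply: ler_sum => l _.
have [h|/waP[ai bl]] := eqVneq (w i l * a i) 0.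
  by rewrite h !mul0r subrr sub0r oppr_le0 mulr_ge0.
rewrite -!mulrA -!mulrBr ler_wpM2l// -ln_div// -[ln _]opprK -lnV ?posrE ?divr_gt0// invf_div.
have h : ln (b l / a i) <= b l / a i - 1.
  rewrite -[X in ln X](addrNK 1) addrC; apply: le_ln1Dx.
  by rewrite ltrBrDr addNr divr_gt0.
have : a i * ln (b l / a i) <= a i * (b l / a i - 1) by rewrite ler_wpM2l// ltW.
by rewrite mulrBr mulrCA divff ?gt_eqF// !mulr1 mulrN; lra.
Qed.

(** * Adjoints and positive matrices *)

Section Adjoint.
Variable R : realType.
Local Notation C := R[i].

Lemma adjE p q (A : 'M[C]_(p, q)) i j : adj A i j = (A j i)^*.
Proof. by rewrite !mxE. Qed.

Lemma adj_t p q (A : 'M[C]_(p, q)) : map_mx conjC A^T = adj A.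
Proof. by rewrite /adj map_trmx. Qed.

Lemma adjK p q (A : 'M[C]_(p, q)) : adj (adj A) = A.
Proof. by apply/matrixP => i j; rewrite !adjE conjCK. Qed.

Lemma adjM p q r (A : 'M[C]_(p, q)) (B : 'M_(q, r)) :
  adj (A *m B) = adj B *m adj A.
Proof. by rewrite /adj map_mxM trmx_mul. Qed.

Lemma adjD p q (A B : 'M[C]_(p, q)) : adj (A + B) = adj A + adj B.
Proof. by rewrite /adj map_mxD linearD. Qed.

Lemma adjB p q (A B : 'M[C]_(p, q)) : adj (A - B) = adj A - adj B.
Proof. by rewrite /adj map_mxB linearB. Qed.

Lemma adjZ p q c (A : 'M[C]_(p, q)) : adj (c *: A) = c^* *: adj A.
Proof. by rewrite /adj map_mxZ linearZ. Qed.

Lemma adj_sum p q (I : Type) (r : seq I) (P : pred I) (A : I -> 'M[C]_(p, q)) :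
  adj (\sum_(i <- r | P i) A i) = \sum_(i <- r | P i) adj (A i).
Proof.
elim/big_rec2: _ => [|i x y _ <-]; first by rewrite /adj map_mx0 linear0.
exact: adjD.
Qed.

Lemma adj1 n : adj (1%:M : 'M[C]_n) = 1%:M.
Proof. by rewrite /adj map_mx1 trmx1. Qed.

Lemma adj_delta p q i j : adj (delta_mx i j : 'M[C]_(p, q)) = delta_mx j i.
Proof. by rewrite /adj map_delta_mx trmx_delta. Qed.

Lemma conjC_real (r : R) : (r%:C)^* = r%:C.
Proof. exact: conjc_real. Qed.

Lemma adj_scalar n (r : R) : adj ((r%:C)%:M : 'M[C]_n) = (r%:C)%:M.
Proof. by rewrite /adj map_scalar_mx tr_scalar_mx; congr (_%:M); exact: conjC_real. Qed.

Lemma scale_regular (u v : C) : u *: (v : C^o) = u * v.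
Proof. by []. Qed.

(** The hypotheses say that [c * p + c^* * q] is real for [c = 1] and [c = 'i]; this determines [q]
    from [p]. *)
Lemma conj_from_polarization (F : numClosedFieldType) (p q : F) :
  p^* + q^* = p + q -> - 'i * p^* + 'i * q^* = 'i * p + - 'i * q -> q^* = p.
Proof.
move=> h1 h2.
have h3 : q^* - p^* = p - q.
  by apply: (mulfI (neq0Ci F)); rewrite !mulrBr addrC -mulNr h2 mulNr.
have : q^* *+ 2 = p *+ 2.
  rewrite (_ : _ *+ 2 = (p^* + q^*) + (q^* - p^*)); last by ring.
  by rewrite h1 h3; ring.
by move/eqP; rewrite eqrMn2r // => /eqP.
Qed.

Lemma psd_herm n (A : 'M[C]_n) : psd A -> adj A = A.
Proof.
move=> Apsd.
have exq i j (c : C) :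
    (adj (delta_mx i 0 + c *: delta_mx j 0 : 'cV_n) *m A
      *m (delta_mx i 0 + c *: delta_mx j 0 : 'cV_n)) 0 0
    = A i i + c * A i j + c^* * A j i + c^* * c * A j j.
  have E k l : delta_mx 0 k *m A *m delta_mx l 0 = (A k l)%:M :> 'M_1.
    by rewrite -rowE -colE [LHS]mx11_scalar !mxE.
  rewrite adjD adjZ !adj_delta mulmxDl !mulmxDr !mulmxDl -!scalemxAl -!scalemxAr.
  by rewrite !E !mxE !eqxx !mulr1n; ring.
(* The form is real on [delta_i + c delta_j], and so are the diagonal entries (case [c = 0]);
   subtracting them leaves the cross term. *)
have re i j c : (c * A i j + c^* * A j i)^* = c * A i j + c^* * A j i.
  have h k l d : (A k k + d * A k l + d^* * A l k + d^* * d * A l l)^*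
      = A k k + d * A k l + d^* * A l k + d^* * d * A l l.
    by apply/CrealP/ger0_real; rewrite -exq; exact: Apsd.
  have d0 k : (A k k)^* = A k k by have := h k k 0; rewrite conjC0 !mul0r !addr0.
  have := h i j c; rewrite !rmorphD /= !rmorphM /= !d0 !conjCK.
  move/eqP; rewrite -subr_eq0 => /eqP H.
  by apply/eqP; rewrite -subr_eq0; apply/eqP; rewrite -[RHS]H; ring.
apply/matrixP => i j; rewrite adjE.
have h1 := re i j 1; have h2 := re i j 'i.
move: h1 h2; rewrite !rmorphD /= !rmorphM /= !conjCi !rmorphN /= ?conjCi ?opprK.
rewrite !conjC1 !mul1r => h1 h2.
exact: conj_from_polarization h1 h2.
Qed.

Lemma psd_congr n p (A : 'M[C]_n) (Y : 'M_(n, p)) :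
  psd A -> psd (adj Y *m A *m Y).
Proof. by move=> Ap x; have := Ap (Y *m x); rewrite adjM !mulmxA. Qed.

Lemma psd_diag_ge0 n (A : 'M[C]_n) i : psd A -> 0 <= A i i.
Proof.
by move/(_ (delta_mx i 0)); rewrite adj_delta -rowE -colE !mxE.
Qed.

Lemma psd_trace_ge0 n (A : 'M[C]_n) : psd A -> 0 <= \tr A.
Proof. by move=> Ap; apply: sumr_ge0 => i _; apply: psd_diag_ge0. Qed.

Lemma psd_sum n (I : finType) (c : I -> R) (A : I -> 'M[C]_n) :
  (forall i, 0 <= c i) -> (forall i, psd (A i)) ->
  psd (\sum_i (c i)%:C *: A i).
Proof.
move=> c0 Ap x; rewrite mulmx_sumr mulmx_suml summxE sumr_ge0// => i _.
by rewrite -scalemxAr -scalemxAl mxE mulr_ge0 ?lecR ?c0//; exact: Ap.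
Qed.

Definition rdiag n (a : 'I_n -> R) : 'M[C]_n := diag_mx (\row_i (a i)%:C).

(** A positive matrix is Hermitian, hence normal. Its eigenvalues are diagonal entries of a
    congruent positive matrix, so taking real parts loses nothing. *)
Lemma psd_spectral n (A : 'M[C]_n) (U := spectralmx A)
    (a := fun i => complex.Re (spectral_diag A 0 i)) : psd A ->
  [/\ U *m adj U = 1%:M, adj U *m U = 1%:M, A = adj U *m rdiag a *m U
    & forall i, 0 <= a i].
Proof.
move=> Ap.
have UU : U *m adj U = 1%:M.
  by have /unitarymxP := spectral_unitarymx A; rewrite adj_t.
have UU' := mulmx1C UU.
have An : A \is normalmx by apply/normalmxP; rewrite adj_t (psd_herm Ap).
have E : A = adj U *m diag_mx (spectral_diag A) *m U.
  have /orthomx_spectralP := An.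
  by rewrite invmx_unitary ?spectral_unitarymx// adj_t.
have D : U *m A *m adj U = diag_mx (spectral_diag A).
  by rewrite [X in _ *m X *m _]E !mulmxA UU mul1mx -mulmxA UU mulmx1.
have ge0 i : 0 <= spectral_diag A 0 i.
  have := psd_diag_ge0 i (psd_congr (adj U) Ap).
  by rewrite adjK D !mxE eqxx mulr1n.
have a_eq : diag_mx (spectral_diag A) = rdiag a.
  by congr diag_mx; apply/rowP => i; rewrite !mxE RRe_real// ger0_real.
split=> //; first by rewrite -a_eq.
by move=> i; rewrite -lecR RRe_real// ger0_real.
Qed.

Lemma trace_rdiag n (a : 'I_n -> R) : \tr (rdiag a) = (\sum_i a i)%:C.
Proof.
by rewrite mxtrace_diag rmorph_sum; apply: eq_bigr => i _; rewrite mxE.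
Qed.

Lemma diag_congrE n p (a : 'I_n -> R) (g : 'M[C]_(n, p)) l :
  (adj g *m rdiag a *m g) l l = \sum_i (a i)%:C * `|g i l| ^+ 2.
Proof.
rewrite mxE; apply: eq_bigr => i _.
by rewrite mul_mx_diag !mxE normCK; ring.
Qed.

Lemma trace_diag_congr n p (a : 'I_n -> R) (g : 'M[C]_(n, p)) :
  \tr (adj g *m rdiag a *m g) = \sum_i \sum_l (a i)%:C * `|g i l| ^+ 2.
Proof. by rewrite exchange_big; apply: eq_bigr => l _; rewrite diag_congrE. Qed.

Lemma norm_adjE p q (A : 'M[C]_(p, q)) i j : `|adj A i j| = `|A j i|.
Proof. by rewrite adjE norm_conjC. Qed.

(** A squared modulus valued in [R] rather than [C], as the classical inequalities require real
    kernels. *)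
Definition sqnorm (z : C) : R := complex.Re z ^+ 2 + complex.Im z ^+ 2.

Lemma sqnormE (z : C) : (sqnorm z)%:C = `|z| ^+ 2.
Proof. exact: add_Re2_Im2. Qed.

Lemma sqnorm_ge0 (z : C) : 0 <= sqnorm z.
Proof. by rewrite addr_ge0 ?sqr_ge0. Qed.

Lemma unitary_row_sum n (W : 'M[C]_n) i :
  W *m adj W = 1%:M -> \sum_l sqnorm (W i l) = 1.
Proof.
move=> WW; apply: (@complexI R); rewrite rmorph_sum.
transitivity ((W *m adj W) i i); last by rewrite WW mxE eqxx.
by rewrite mxE; apply: eq_bigr => l _; rewrite adjE -normCK -sqnormE.
Qed.

(* The variational bound behind the superadditivity of the parallel sum:
   equality would need [Y = c], [Z = 1 - c] on the support of [s]. *)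
Lemma parallel_sum_le n (s Y Z : 'M[C]_n) (x y : R) :
  psd s -> \tr s = 1 -> 0 <= x -> 0 < y -> Y + Z = 1%:M ->
  (x * y / (x + y))%:C
    <= x%:C * \tr (adj Y *m s *m Y) + y%:C * \tr (Z *m s *m adj Z).
Proof.
move=> sp s1 x0 y0 YZ.
have xy : 0 < x + y by rewrite ltr_wpDl.
(* The scalar minimizers for [Y] and [Z]. Positivity of the forms at [Y - c] and [Z - c'] bounds the
   quadratic terms below by affine ones. *)
pose c := y / (x + y); pose c' := x / (x + y).
pose al := \tr (s *m Y); pose be := \tr (adj Y *m s).
have al' : \tr (Z *m s) = 1 - al.
  by rewrite mxtrace_mulC /al -s1 -linearB /= -[X in X - _]mulmx1 -mulmxBr -YZ addrC addKr.
have be' : \tr (s *m adj Z) = 1 - be.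
  rewrite /be [\tr (adj Y *m s)]mxtrace_mulC -s1 -linearB /= -[X in X - _]mulmx1 -mulmxBr.
  by rewrite -adj1 -YZ adjD addrC addKr.
have hY : c%:C * (al + be) - c%:C ^+ 2 <= \tr (adj Y *m s *m Y).
  rewrite -subr_ge0; have := psd_trace_ge0 (psd_congr (Y - (c%:C)%:M) sp).
  rewrite adjB adj_scalar !(mulmxBr, mulmxBl) !mul_scalar_mx !mul_mx_scalar.
  rewrite !linearB /= -!scalemxAl !linearZ /= -/al -/be s1.
  rewrite !scale_regular; congr (_ <= _); ring.
have hZ : c'%:C * ((1 - al) + (1 - be)) - c'%:C ^+ 2 <= \tr (Z *m s *m adj Z).
  rewrite -subr_ge0; have := psd_trace_ge0 (psd_congr (adj (Z - (c'%:C)%:M)) sp).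
  rewrite adjK adjB adj_scalar !(mulmxBr, mulmxBl) !mul_scalar_mx !mul_mx_scalar.
  rewrite !linearB /= -!scalemxAl !linearZ /= -al' -be' s1.
  by rewrite !scale_regular; congr (_ <= _); ring.
have := lerD (ler_wpM2l _ hY) (ler_wpM2l _ hZ).
move=> /(_ x%:C y%:C); rewrite !lecR => /(_ x0 (ltW y0)); apply: le_trans.
(* Since [x c = y c' = k], the traces [al] and [be] cancel between the two bounds, and
   [2 k - k (c + c') = k] remains. *)
have k1 : x%:C * c%:C = (x * y / (x + y))%:C by rewrite -rmorphM mulrA.
have k2 : y%:C * c'%:C = (x * y / (x + y))%:C by rewrite -rmorphM mulrA [y * x]mulrC.
have cc : c%:C + c'%:C = 1 by rewrite -rmorphD -mulrDl addrC divff ?gt_eqF.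
rewrite !mulrBr !expr2 !mulrA k1 k2 le_eqVlt; apply/orP; left; apply/eqP.
rewrite -[LHS]mulr1 -[in LHS]cc; move: (_ / _)%:C => k.
have -> : c'%:C = 1 - c%:C by rewrite -cc addrC addKr.
ring.
Qed.

End Adjoint.

(** * Entropy of matrices *)

Section Entropy.
Variable R : realType.
Local Notation C := R[i].

Lemma sqnormM_real (k y : R) (z : C) :
  (k * (y ^+ 2 * sqnorm z))%:C = k%:C * `|y%:C * z| ^+ 2.
Proof.
rewrite normrM exprMn -!sqnormE -!rmorphM; congr (_ * (_ * _))%:C.
by rewrite /sqnorm /= expr0n addr0.
Qed.

Lemma psd_trace_re n (A : 'M[C]_n) :
  psd A -> (\sum_i complex.Re (spectral_diag A 0 i))%:C = \tr A.
Proof.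
case/psd_spectral => UU _ E _; rewrite -trace_rdiag [in RHS]E -mulmxA mxtrace_mulC.
by rewrite -mulmxA UU mulmx1.
Qed.

(** The squared moduli of the entries of a unitary form a doubly stochastic kernel, which carries
    the eigenvalues of [A] to its diagonal in another basis. *)
Lemma vN_entropy_le_diag n (A V : 'M[C]_n) (b : 'I_n -> R) :
  psd A -> V *m adj V = 1%:M -> (forall l, (V *m A *m adj V) l l = (b l)%:C) ->
  vN_entropy A <= shannon b.
Proof.
move=> Ap VV Vb; have [UU UU' E a0] := psd_spectral Ap.
set U := spectralmx A in UU UU' E; have VV' := mulmx1C VV.
set a := (fun i => complex.Re (spectral_diag A 0 i)) in E a0.
pose W := U *m adj V.
have WW : W *m adj W = 1%:M.
  by rewrite adjM adjK !mulmxA -[U *m _ *m _]mulmxA VV' mulmx1.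
have WW' : adj W *m adj (adj W) = 1%:M by rewrite adjK; exact: mulmx1C WW.
rewrite lerN2; apply: (@sum_xlogx_mix_le R _ _ a b (fun i l => sqnorm (W i l))).
- exact: a0.
- by move=> i l; exact: sqnorm_ge0.
- by move=> i; exact: unitary_row_sum.
- move=> l; rewrite -[RHS](unitary_row_sum l WW'); apply: eq_bigr => i _.
  by apply: (@complexI R); rewrite !sqnormE norm_adjE.
- move=> l; apply: (@complexI R); rewrite -Vb [in RHS]E rmorph_sum.
  have -> : V *m (adj U *m rdiag a *m U) *m adj V = adj W *m rdiag a *m W.
    by rewrite /W adjM adjK !mulmxA.
  by rewrite diag_congrE; apply: eq_bigr => i _; rewrite -sqnormE -rmorphM.
Qed.

(* Joint convexity of the relative entropy [D(A || B) <= D(lam || mu)] for the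
   mixtures [A], [B] of the same states, when [B] is diagonal in the basis of
   rows of [V] and [A] has the same diagonal there. *)
Lemma vN_entropy_mixture_ge n (J : finType) (s : J -> 'M[C]_n) (lam mu : J -> R)
    (V : 'M[C]_n) (b : 'I_n -> R) :
  let A := \sum_j (lam j)%:C *: s j in
  let B := \sum_j (mu j)%:C *: s j in
  (forall j, psd (s j)) -> (forall j, \tr (s j) = 1) ->
  (forall j, 0 <= lam j) -> (forall j, 0 < mu j) ->
  V *m adj V = 1%:M -> V *m B *m adj V = rdiag b ->
  (forall l, (V *m A *m adj V) l l = (b l)%:C) ->
  shannon b + \sum_j lam j * ln (mu j) - \sum_j xlogx (lam j) <= vN_entropy A.
Proof.
move=> A B sp s1 lam0 mu0 VV VB VA.
have Ap : psd A by exact: psd_sum.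
have [UU UU' E a0] := psd_spectral Ap.
set U := spectralmx A in UU UU' E; have VV' := mulmx1C VV.
have trA := psd_trace_re Ap.
rewrite /vN_entropy.
set a := (fun i => complex.Re (spectral_diag A 0 i)) in E a0 trA *.
(* Overlaps of the eigenbasis of [A] with that of [B]; their squared moduli are the kernel fed to
   [relative_entropy_le]. *)
pose W := U *m adj V.
have WW : W *m adj W = 1%:M.
  by rewrite adjM adjK !mulmxA -[U *m _ *m _]mulmxA VV' mulmx1.
have ab l : \sum_i a i * sqnorm (W i l) = b l.
  apply: (@complexI R); rewrite -VA [in RHS]E rmorph_sum.
  have -> : V *m (adj U *m rdiag a *m U) *m adj V = adj W *m rdiag a *m W.
    by rewrite /W adjM adjK !mulmxA.
  by rewrite diag_congrE; apply: eq_bigr => i _; rewrite -sqnormE -rmorphM.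
have := @relative_entropy_le R _ _ _ a b (fun i l => sqnorm (W i l)) lam mu a0 _ _ ab lam0 mu0 _ _.
have b0 l : 0 <= b l.
  by rewrite -ab sumr_ge0// => i _; rewrite mulr_ge0 ?sqnorm_ge0 ?a0.
have aux : forall t : R, 0 < t -> \sum_j lam j * mu j / (lam j + t * mu j)
    <= \sum_i \sum_l sqnorm (W i l) * (a i * b l / (a i + t * b l)).
  move=> t t0.
  (* The minimizer of [a y^2 + t b (1 - y)^2], with minimum [t a b / (a + t b)]. Weighting the
     entries of [W] by it gives the optimal [Y] between the two eigenbases. *)
  pose y i l := t * b l / (a i + t * b l).
  pose g := \matrix_(i, l) ((y i l)%:C * W i l).
  pose h := W - g.
  pose Y := adj U *m g *m V; pose Z := adj U *m h *m V.
  have YZ : Y + Z = 1%:M.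
    rewrite -mulmxDl -mulmxDr /h addrC subrK /W !mulmxA UU' mul1mx.
    exact: mulmx1C.
  have HY : \tr (adj Y *m A *m Y) = (\sum_i \sum_l a i * (y i l ^+ 2 * sqnorm (W i l)))%:C.
    transitivity (\tr (adj g *m rdiag a *m g)).
      rewrite [in LHS]E /Y !adjM adjK !mulmxA mxtrace_mulC !mulmxA VV mul1mx.
      by rewrite -[_ *m U *m adj U]mulmxA UU mulmx1 -[_ *m U *m adj U]mulmxA UU mulmx1.
    rewrite trace_diag_congr rmorph_sum; apply: eq_bigr => i _ /=.
    rewrite rmorph_sum; apply: eq_bigr => l _ /=.
    by rewrite mxE -sqnormM_real.
  have HZ : \tr (Z *m B *m adj Z) = (\sum_i \sum_l b l * ((1 - y i l) ^+ 2 * sqnorm (W i l)))%:C.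
    transitivity (\tr (h *m rdiag b *m adj h)).
      rewrite -VB /Z !adjM adjK !mulmxA mxtrace_mulC !mulmxA UU mul1mx.
      by congr (\tr (_ *m _)); rewrite !mulmxA.
    rewrite -[X in \tr (X *m _ *m _)]adjK trace_diag_congr.
    rewrite exchange_big rmorph_sum; apply: eq_bigr => i _ /=.
    rewrite rmorph_sum; apply: eq_bigr => l _ /=.
    have -> : `|adj h l i| = `|(1 - y i l)%:C * W i l|.
      by rewrite norm_adjE !mxE [(1 - _)%:C]rmorphB mulrBl mul1r.
    by rewrite -sqnormM_real.
  (* Superadditivity: the form is additive over the mixture, and [parallel_sum_le] applies to each
     [s j] with the same [Y] and [Z]. *)
  have : (\sum_j lam j * (t * mu j) / (lam j + t * mu j))%:C
      <= \tr (adj Y *m A *m Y) + t%:C * \tr (Z *m B *m adj Z).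
    have -> : \tr (adj Y *m A *m Y) + t%:C * \tr (Z *m B *m adj Z)
       = \sum_j ((lam j)%:C * \tr (adj Y *m s j *m Y)
                 + (t * mu j)%:C * \tr (Z *m s j *m adj Z)).
      rewrite big_split /=; congr (_ + _).
        rewrite mulmx_sumr mulmx_suml linear_sum; apply: eq_bigr => j _ /=.
        by rewrite -scalemxAr -scalemxAl mxtraceZ.
      rewrite mulmx_sumr mulmx_suml linear_sum mulr_sumr; apply: eq_bigr => j _ /=.
      by rewrite -scalemxAr -scalemxAl mxtraceZ rmorphM mulrA.
    rewrite rmorph_sum; apply: ler_sum => j _ /=.
    by apply: parallel_sum_le => //; rewrite mulr_gt0.
  rewrite HY HZ -rmorphM -rmorphD lecR.
  have -> : \sum_j lam j * (t * mu j) / (lam j + t * mu j)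
      = t * \sum_j lam j * mu j / (lam j + t * mu j).
    by rewrite mulr_sumr; apply: eq_bigr => j _; rewrite mulrCA !mulrA.
  move=> H; rewrite -(ler_pM2l t0); apply: le_trans H _.
  rewrite !mulr_sumr -big_split /= ler_sum // => i _.
  rewrite !mulr_sumr -big_split /= ler_sum // => l _.
  (* If the denominator is zero, then [a i] and [b l] are both zero and the two sides vanish. *)
  have [d0|dn0] := eqVneq (a i + t * b l) 0.
    have tb0 : 0 <= t * b l by rewrite mulr_ge0 ?(ltW t0) ?b0.
    have /andP[/eqP ai] : (a i == 0) && (t * b l == 0).
      by rewrite -(paddr_eq0 (a0 i) tb0); apply/eqP.
    rewrite mulf_eq0 gt_eqF //= => /eqP bl.
    by rewrite ai bl !mul0r !mulr0 !addr0.
  by rewrite le_eqVlt; apply/orP; left; apply/eqP; rewrite /y; field.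
move=> H; have {}H := H _ _ _ aux.
rewrite /shannon.
suff : \sum_i xlogx (a i) - \sum_l xlogx (b l) <=
  \sum_j xlogx (lam j) - \sum_j lam j * ln (mu j) by lra.
apply: H.
- by move=> i l; exact: sqnorm_ge0.
- by move=> i; exact: unitary_row_sum.
- apply: (@complexI R); rewrite trA linear_sum rmorph_sum /=; apply: eq_bigr => j _.
  by rewrite mxtraceZ s1 mulr1.
Qed.

Lemma vN_entropy_ge0 n (A : 'M[C]_n) : is_state A -> 0 <= vN_entropy A.
Proof.
move=> [Ap A1]; have [_ _ _ a0] := psd_spectral Ap.
have := psd_trace_re Ap; rewrite A1 => /(@complexI R _ 1) s1.
rewrite oppr_ge0 sumr_le0// => i _; rewrite xlogxM_ln mulr_ge0_le0//.
apply: ln_le0; rewrite -s1 (bigD1 i)//= lerDl sumr_ge0// => k _; exact: a0.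
Qed.

End Entropy.

(** * Block structure of tensor products *)

Section Tensor.
Variable R : realType.
Local Notation C := R[i].

Lemma mxvec_index_eq m n (i j : 'I_m) (k l : 'I_n) :
  (mxvec_index i k == mxvec_index j l) = (i == j) && (k == l).
Proof.
apply/eqP/andP => [|[/eqP-> /eqP->]//].
have [g gK _] := @curry_mxvec_bij m n.
move=> h; have := gK (i, k) isT; rewrite /= h (gK (j, l) isT) => -[-> ->].
by rewrite !eqxx.
Qed.

Lemma sum_mxvec (V : nmodType) m n (F : 'I_(m * n) -> V) :
  \sum_x F x = \sum_i \sum_k F (mxvec_index i k).
Proof.
rewrite pair_big (reindex (uncurry (@mxvec_index m n))) /=; last exact: curry_mxvec_bij.
by apply: eq_bigr => -[].
Qed.

(* The isometry [k |-> delta_i (x) k]. *)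
Definition blk_inj d m (i : 'I_d) : 'M[C]_(d * m, m) :=
  \matrix_(a, l) (a == mxvec_index i l)%:R.

(** The operator [<i| X |j>] on the second factor. Tensor identities are checked block by block with
    [block_inj], which avoids most computations on flattened indices. *)
Definition block d m (X : 'M[C]_(d * m)) (i j : 'I_d) : 'M[C]_m :=
  \matrix_(k, l) X (mxvec_index i k) (mxvec_index j l).

Lemma blk_injE d m (i : 'I_d) : blk_inj m i = \sum_l delta_mx (mxvec_index i l) l :> 'M_(d * m, m).
Proof.
apply/matrixP => a l; rewrite summxE (bigD1 l)//= big1 => [|k kl].
  by rewrite !mxE eqxx andbT addr0.
by rewrite !mxE [l == k]eq_sym (negPf kl) andbF.
Qed.

Lemma blk_inj_mul d m p (i : 'I_d) (Y : 'M_(d * m, p)) k l :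
  (adj (blk_inj m i) *m Y) k l = Y (mxvec_index i k) l.
Proof.
rewrite mxE (bigD1 (mxvec_index i k))//= big1 => [|a ak].
  by rewrite !mxE eqxx conjC1 mul1r addr0.
by rewrite !mxE (negPf ak) conjC0 mul0r.
Qed.

Lemma mul_blk_inj d m p (i : 'I_d) (Y : 'M_(p, d * m)) k l :
  (Y *m blk_inj m i) k l = Y k (mxvec_index i l).
Proof.
rewrite mxE (bigD1 (mxvec_index i l))//= big1 => [|a ak].
  by rewrite !mxE eqxx mulr1 addr0.
by rewrite !mxE (negPf ak) mulr0.
Qed.

Lemma blockE d m (X : 'M_(d * m)) i j :
  block X i j = adj (blk_inj m i) *m X *m blk_inj m j.
Proof. by apply/matrixP => k l; rewrite mul_blk_inj blk_inj_mul mxE. Qed.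

Lemma block_inj d m (X Y : 'M[C]_(d * m)) :
  (forall i j, block X i j = block Y i j) -> X = Y.
Proof.
move=> XY; apply/matrixP => a b.
case/mxvec_indexP: a => i k; case/mxvec_indexP: b => j l.
by have /matrixP/(_ k l) := XY i j; rewrite !mxE.
Qed.

Lemma blk_inj_ortho d m (i j : 'I_d) :
  adj (blk_inj m i) *m blk_inj m j = ((i == j)%:R)%:M :> 'M_m.
Proof.
apply/matrixP => k l; rewrite blk_inj_mul !mxE mxvec_index_eq.
by case: (i == j); case: (k == l).
Qed.

Lemma blk_inj_complete d m :
  \sum_(i < d) blk_inj m i *m adj (blk_inj m i) = 1%:M :> 'M_(d * m).
Proof.
apply: block_inj => i j; rewrite !blockE mulmx1 mulmx_sumr mulmx_suml.
rewrite (bigD1 i)//= big1 => [|k ki].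
  by rewrite mulmxA blk_inj_ortho eqxx mul1mx addr0.
by rewrite mulmxA blk_inj_ortho eq_sym (negPf ki) !mul_scalar_mx scale0r mul0mx.
Qed.

Lemma kron_blk d m (A : 'M[C]_d) (B : 'M_m) :
  kron A B = \sum_i \sum_j A i j *: (blk_inj m i *m B *m adj (blk_inj m j)).
Proof.
rewrite /kron; apply: eq_bigr => i _; apply: eq_bigr => j _.
rewrite [in RHS](matrix_sum_delta B) mulmx_sumr mulmx_suml scaler_sumr.
apply: eq_bigr => k _; rewrite mulmx_sumr mulmx_suml scaler_sumr.
apply: eq_bigr => l _; rewrite -scalemxAr -scalemxAl scalerA; congr (_ *: _).
rewrite !blk_injE adj_sum mulmx_suml (bigD1 k)//= [X in _ + X]big1 => [|k' kk']; last first.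
  by rewrite mul_delta_mx_0.
rewrite mul_delta_mx addr0 mulmx_sumr (bigD1 l)//= big1 => [|l' ll'].
  by rewrite adj_delta mul_delta_mx addr0.
by rewrite adj_delta mul_delta_mx_0// eq_sym.
Qed.

Lemma block_kron d m (A : 'M[C]_d) (B : 'M_m) i j : block (kron A B) i j = A i j *: B.
Proof.
rewrite kron_blk blockE mulmx_sumr mulmx_suml (bigD1 i)//= [X in _ + X]big1 => [|i' ii'].
  rewrite addr0 mulmx_sumr mulmx_suml (bigD1 j)//= [X in _ + X]big1 => [|j' jj'].
    rewrite -scalemxAr -scalemxAl !mulmxA blk_inj_ortho eqxx mul1mx.
    by rewrite -mulmxA blk_inj_ortho eqxx mulmx1 addr0.
  rewrite -scalemxAr -scalemxAl -!mulmxA blk_inj_ortho (negPf jj').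
  by rewrite mul_mx_scalar scale0r !mulmx0 scaler0.
rewrite mulmx_sumr mulmx_suml big1// => j' _.
rewrite -scalemxAr -scalemxAl !mulmxA blk_inj_ortho eq_sym (negPf ii').
by rewrite mul_scalar_mx scale0r !mul0mx scaler0.
Qed.

Lemma block_mul d m (X Y : 'M[C]_(d * m)) i j :
  block (X *m Y) i j = \sum_k block X i k *m block Y k j.
Proof.
rewrite blockE -[X in X *m Y]mulmx1 -blk_inj_complete.
rewrite mulmx_sumr !mulmx_suml mulmx_sumr mulmx_suml.
by apply: eq_bigr => k _; rewrite !blockE !mulmxA.
Qed.

Lemma block_sum d m (I : Type) (r : seq I) (P : pred I) (X : I -> 'M[C]_(d * m)) i j :
  block (\sum_(x <- r | P x) X x) i j = \sum_(x <- r | P x) block (X x) i j.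
Proof. by rewrite blockE mulmx_sumr mulmx_suml; apply: eq_bigr => x _; rewrite blockE. Qed.

Lemma blockZ d m c (X : 'M[C]_(d * m)) i j : block (c *: X) i j = c *: block X i j.
Proof. by rewrite !blockE -scalemxAr -scalemxAl. Qed.

Lemma kronM d m (A A' : 'M[C]_d) (B B' : 'M_m) :
  kron A B *m kron A' B' = kron (A *m A') (B *m B').
Proof.
apply: block_inj => i j; rewrite block_mul block_kron mxE scaler_suml.
by apply: eq_bigr => k _; rewrite !block_kron -scalemxAl -scalemxAr scalerA.
Qed.

Lemma block_adj d m (X : 'M[C]_(d * m)) i j : block (adj X) i j = adj (block X j i).
Proof. by apply/matrixP => k l; rewrite !mxE. Qed.

Lemma adj_kron d m (A : 'M[C]_d) (B : 'M_m) : adj (kron A B) = kron (adj A) (adj B).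
Proof. by apply: block_inj => i j; rewrite block_adj !block_kron adjZ adjE. Qed.

Lemma kron11 d m : kron 1%:M 1%:M = 1%:M :> 'M[C]_(d * m).
Proof.
apply: block_inj => i j; rewrite block_kron blockE mulmx1 blk_inj_ortho mxE.
by rewrite scale_scalar_mx mulr1.
Qed.

Lemma kron_suml d m (I : Type) (r : seq I) (P : pred I) (c : I -> C)
    (A : I -> 'M[C]_d) (B : 'M_m) :
  kron (\sum_(x <- r | P x) c x *: A x) B = \sum_(x <- r | P x) c x *: kron (A x) B.
Proof.
apply: block_inj => i j; rewrite block_kron block_sum summxE scaler_suml.
by apply: eq_bigr => x _; rewrite blockZ block_kron mxE scalerA.
Qed.

Lemma linear_mx_sum m (F : 'M[C]_m -> 'M[C]_m) (I : Type) (r : seq I) (P : pred I)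
    (c : I -> C) (A : I -> 'M[C]_m) : linear F ->
  F (\sum_(x <- r | P x) c x *: A x) = \sum_(x <- r | P x) c x *: F (A x).
Proof.
move=> Fl; elim/big_rec2: _ => [|x y z _ <-]; last exact: Fl.
(* The empty sum needs [F 0 = 0], which follows from [F 0 = F 0 + F 0]. *)
have := Fl 1 0 0; rewrite !scale1r addr0 => /eqP.
by rewrite -subr_eq0 opprD addrA subrr sub0r oppr_eq0 => /eqP.
Qed.

Lemma block_tensmap_id d m (F : 'M[C]_m -> 'M[C]_m) (X : 'M_(d * m)) i j :
  linear F -> block (tensmap id F X) i j = F (block X i j).
Proof.
move=> Fl; rewrite (matrix_sum_delta (block X i j)).
rewrite block_sum (bigD1 i)//= [X in _ + X]big1 => [|i' ii'].
  rewrite addr0 block_sum (bigD1 j)//= [X in _ + X]big1 => [|j' jj'].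
    rewrite addr0 block_sum.
    rewrite -[X in F X]scale1r [X in F (1 *: X)](eq_bigr (fun k =>
      1 *: \sum_l block X i j k l *: delta_mx k l)); last by move=> k _; rewrite scale1r.
    rewrite scale1r linear_mx_sum//; apply: eq_bigr => k _; rewrite scale1r.
    rewrite linear_mx_sum// block_sum; apply: eq_bigr => l _.
    by rewrite blockZ block_kron !mxE !eqxx scale1r.
  rewrite block_sum big1// => k _; rewrite block_sum big1// => l _.
  by rewrite blockZ block_kron !mxE [j == j']eq_sym (negPf jj') andbF scale0r scaler0.
rewrite block_sum big1// => j' _; rewrite block_sum big1// => k _; rewrite block_sum big1// => l _.
by rewrite blockZ block_kron !mxE [i == i']eq_sym (negPf ii') scale0r scaler0.
Qed.

(** Exhibits the output of the product channel as a mixture of conjugates of the single matrix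
    [tensmap id G X]. *)
Lemma tensmap_kraus d m n (W : 'I_n -> 'M[C]_d) (c : 'I_n -> C)
    (F : 'M[C]_d -> 'M[C]_d) (G : 'M[C]_m -> 'M[C]_m) (X : 'M_(d * m)) :
  (forall Y, F Y = \sum_j c j *: (W j *m Y *m adj (W j))) ->
  tensmap F G X = \sum_j c j *:
    (kron (W j) 1%:M *m tensmap id G X *m adj (kron (W j) 1%:M)).
Proof.
move=> FE; rewrite /tensmap.
under [RHS]eq_bigr do rewrite mulmx_sumr mulmx_suml scaler_sumr.
rewrite [RHS]exchange_big; apply: eq_bigr => i _ /=.
under [RHS]eq_bigr do rewrite mulmx_sumr mulmx_suml scaler_sumr.
rewrite [RHS]exchange_big; apply: eq_bigr => j _ /=.
under [RHS]eq_bigr do rewrite mulmx_sumr mulmx_suml scaler_sumr.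
rewrite [RHS]exchange_big; apply: eq_bigr => k _ /=.
under [RHS]eq_bigr do rewrite mulmx_sumr mulmx_suml scaler_sumr.
rewrite [RHS]exchange_big; apply: eq_bigr => l _ /=.
rewrite FE kron_suml scaler_sumr; apply: eq_bigr => x _.
rewrite -scalemxAr -scalemxAl scalerA mulrC -scalerA; congr (_ *: (_ *: _)).
by rewrite adj_kron !kronM adj1 mulmx1 mul1mx.
Qed.

(* [ten x] is [k |-> x (x) k], so that [slice x y X] is the operator
   [<x| X |y>] on the second factor. *)
Definition ten d m (x : 'cV[C]_d) : 'M[C]_(d * m, m) :=
  \sum_i x i 0 *: blk_inj m i.

Definition slice d m (x y : 'cV[C]_d) (X : 'M[C]_(d * m)) : 'M[C]_m :=
  adj (ten m x) *m X *m ten m y.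

Lemma sliceE d m (x y : 'cV[C]_d) (X : 'M[C]_(d * m)) :
  slice x y X = \sum_i \sum_j ((x i 0)^* * y j 0) *: block X i j.
Proof.
rewrite /slice adj_sum !mulmx_suml; apply: eq_bigr => i _.
rewrite mulmx_sumr; apply: eq_bigr => j _.
by rewrite adjZ -!scalemxAl -scalemxAr scalerA blockE.
Qed.

Lemma tenZ d m c (x : 'cV[C]_d) : ten m (c *: x) = c *: ten m x.
Proof. by rewrite scaler_sumr; apply: eq_bigr => i _; rewrite mxE scalerA. Qed.

Lemma kron_ten d m (A : 'M[C]_d) (x : 'cV[C]_d) :
  kron A 1%:M *m ten m x = ten m (A *m x).
Proof.
rewrite kron_blk mulmx_suml; apply: eq_bigr => i _.
rewrite mulmx_suml mxE scaler_suml; apply: eq_bigr => j _.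
rewrite mulmx1 mulmx_sumr (bigD1 j)//= big1 => [|k kj].
  by rewrite -scalemxAl -scalemxAr -mulmxA blk_inj_ortho eqxx mulmx1 addr0 scalerA.
rewrite -scalemxAl -scalemxAr -mulmxA blk_inj_ortho eq_sym (negPf kj).
by rewrite mul_mx_scalar scale0r !scaler0.
Qed.

Lemma adj_ten_mul d m (x y : 'cV[C]_d) :
  adj (ten m x) *m ten m y = ((adj x *m y) 0 0)%:M.
Proof.
have := sliceE x y (1%:M : 'M_(d * m)); rewrite /slice mulmx1 => ->.
rewrite mxE [RHS]raddf_sum; apply: eq_bigr => i _ /=; rewrite (bigD1 i)//= big1 => [|j ji].
  by rewrite blockE mulmx1 blk_inj_ortho eqxx addr0 scale_scalar_mx mulr1 adjE.
by rewrite blockE mulmx1 blk_inj_ortho eq_sym (negPf ji) scale_scalar_mx mulr0 raddf0.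
Qed.

(** Conjugation on the first factor moves onto the vectors; for eigenvectors of [adj A] it only
    produces scalars. *)
Lemma slice_kron d m (A : 'M[C]_d) (x y : 'cV[C]_d) (X : 'M_(d * m)) :
  slice x y (kron A 1%:M *m X *m adj (kron A 1%:M)) = slice (adj A *m x) (adj A *m y) X.
Proof.
have E z : ten m (adj A *m z) = adj (kron A 1%:M) *m ten m z.
  by rewrite adj_kron adj1 kron_ten.
by rewrite /slice !E adjM adjK !mulmxA.
Qed.

Lemma sliceZ d m c c' (x y : 'cV[C]_d) (X : 'M_(d * m)) :
  slice (c *: x) (c' *: y) X = (c^* * c') *: slice x y X.
Proof. by rewrite /slice !tenZ adjZ -!scalemxAl -scalemxAr scalerA. Qed.

Lemma slice_sum d m (I : finType) (x y : 'cV[C]_d) (c : I -> C) (X : I -> 'M_(d * m)) :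
  slice x y (\sum_i c i *: X i) = \sum_i c i *: slice x y (X i).
Proof.
rewrite /slice; move: (adj _) (ten _ y) => S T.
rewrite mulmx_sumr mulmx_suml; apply: eq_bigr => i _.
by rewrite -scalemxAr -scalemxAl.
Qed.

Lemma slice_tensmap_id d m (F : 'M[C]_m -> 'M[C]_m) (x y : 'cV_d) (X : 'M_(d * m)) :
  linear F -> slice x y (tensmap id F X) = F (slice x y X).
Proof.
move=> Fl; rewrite !sliceE pair_big [in RHS]pair_big /= linear_mx_sum//.
by apply: eq_bigr => -[i j] _; rewrite block_tensmap_id.
Qed.

Lemma trace_block d m (X : 'M[C]_(d * m)) : \tr X = \sum_i \tr (block X i i).
Proof.
rewrite /mxtrace sum_mxvec; apply: eq_bigr => i _.
by apply: eq_bigr => k _; rewrite mxE.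
Qed.

Lemma ptrace2E d m (X : 'M[C]_(d * m)) i j : ptrace2 X i j = \tr (block X i j).
Proof. by rewrite mxE; apply: eq_bigr => k _; rewrite mxE. Qed.

Lemma ptrace1E d m (X : 'M[C]_(d * m)) : ptrace1 X = \sum_i block X i i.
Proof.
by apply/matrixP => k l; rewrite mxE summxE; apply: eq_bigr => i _; rewrite mxE.
Qed.

(** With [x = y] this is the weight of a measurement outcome, so a condition on the first marginal
    controls the weights of the conditional states. *)
Lemma trace_slice d m (x y : 'cV[C]_d) (X : 'M[C]_(d * m)) :
  \tr (slice x y X) = (adj x *m ptrace2 X *m y) 0 0.
Proof.
rewrite sliceE mxE raddf_sum /=.
under [RHS]eq_bigr => j _ do rewrite mxE mulr_suml.
rewrite [RHS]exchange_big; apply: eq_bigr => i _ /=; rewrite raddf_sum.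
by apply: eq_bigr => j _ /=; rewrite mxtraceZ ptrace2E adjE mulrAC.
Qed.

End Tensor.

Arguments blk_inj {R d} m i.

(** * The phase operator *)

Section Phases.
Variable R : realType.
Local Notation C := R[i].

Lemma outer_sandwich n (x y z w : 'cV[C]_n) :
  (adj x *m (y *m adj z *m w)) 0 0 = (adj x *m y) 0 0 * (adj z *m w) 0 0.
Proof. by rewrite -mulmxA mulmxA mxE big_ord1. Qed.

Lemma psd_outer n (y : 'cV[C]_n) : psd (y *m adj y).
Proof.
move=> x; have -> : adj x *m (y *m adj y) *m x = (adj x *m y) *m adj (adj x *m y).
  by rewrite adjM adjK !mulmxA.
by rewrite mxE big_ord1 adjE -normCK exprn_ge0.
Qed.

(** * Roots of unity *)

Lemma cexpD (x y : R) : cexp (x + y) = cexp x * cexp y.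
Proof.
rewrite /cexp cosD sinD; apply/eqP; rewrite eq_complex /=.
by apply/andP; split; apply/eqP; ring.
Qed.

Lemma cexp0 : cexp (0 : R) = 1.
Proof. by rewrite /cexp cos0 sin0. Qed.

Lemma cexpX (x : R) n : cexp x ^+ n = cexp (x * n%:R).
Proof.
elim: n => [|n IH]; first by rewrite mulr0 cexp0.
by rewrite exprS IH -cexpD -natr1 mulrDr mulr1 addrC.
Qed.

Lemma conj_cexp (x : R) : (cexp x)^* = cexp (- x).
Proof. by rewrite /cexp cosN sinN. Qed.

Lemma cexp2pi : cexp (2 * pi : R) = 1.
Proof. by rewrite /cexp mulrC mulr_natr cos2pi sin2pi. Qed.

(** The real part is [1 - 2 sin^2 (x / 2)], and the half angle lies strictly between 0 and [pi]. *)
Lemma cexp_neq1 (x : R) : 0 < x < 2 * pi -> cexp x != 1.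
Proof.
move=> /andP[x0 x2]; rewrite eq_complex /= negb_and; apply/orP; left.
have sx : 0 < sin (x / 2) by apply: sin_gt0_pi; apply/andP; split; lra.
have -> : x = (x / 2) *+ 2 by rewrite -mulr_natr divfK ?pnatr_eq0.
rewrite cos_mulr2n cos2sin2 lt_eqF // mulr2n.
have := exprn_gt0 2 sx; lra.
Qed.

(** The eigenvalues of the phase operator. The index is a [nat], so that powers stay in the family
    without reduction modulo [d]. *)
Definition omega d (s : nat) : C := cexp (2 * pi * s%:R / d%:R).

Lemma omegaX d (s t : nat) : omega d s ^+ t = omega d (s * t).
Proof. by rewrite /omega cexpX natrM; congr cexp; rewrite mulrA mulrAC. Qed.

Lemma omega_unit d s : omega d s * (omega d s)^* = 1.
Proof. by rewrite /omega conj_cexp -cexpD subrr cexp0. Qed.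

Lemma omega_expd d s : (0 < d)%N -> omega d s ^+ d = 1.
Proof.
move=> d0; rewrite /omega cexpX divfK ?pnatr_eq0 -?lt0n//.
by rewrite -cexpX cexp2pi expr1n.
Qed.

Lemma omega_inj d (s t : 'I_d) : omega d s = omega d t -> s = t.
Proof.
have lt_neq (u v : 'I_d) : (u < v)%N -> omega d u != omega d v.
  move=> uv; have d0 : 0 < d%:R :> R by rewrite ltr0n (leq_trans _ (ltn_ord u)).
  have h : cexp (2 * pi * (v - u)%:R / d%:R : R) != 1.
    apply: cexp_neq1; have p0 := @pi_gt0 R; apply/andP; split.
      by rewrite divr_gt0// mulr_gt0// ?mulr_gt0// ltr0n subn_gt0.
    rewrite ltr_pdivrMr// ltr_pM2l ?mulr_gt0// ltr_nat.
    by rewrite (leq_ltn_trans (leq_subr _ _)).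
  apply: contraNneq h => huv; rewrite natrB ?(ltnW uv)// mulrBr mulrBl cexpD -conj_cexp.
  by rewrite -/(omega d v) -/(omega d u) huv omega_unit.
case: (ltngtP s t) => [/lt_neq|/lt_neq|/val_inj//]; last rewrite eq_sym.
  by move=> /negP h /eqP.
by move=> /negP h /eqP.
Qed.

(** Orthogonality of the characters of the cyclic group of order [d]: off the diagonal it is a
    geometric sum whose ratio is a [d]-th root of unity other than 1. *)
Lemma sum_omega d (s t : 'I_d) :
  \sum_(j < d) omega d s ^+ j * (omega d t)^* ^+ j = d%:R * (s == t)%:R.
Proof.
have d0 : (0 < d)%N := leq_trans (ltn0Sn _) (ltn_ord s).
under eq_bigr do rewrite -exprMn.
have [->|st] := eqVneq s t.
  under eq_bigr do rewrite omega_unit expr1n.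
  by rewrite sumr_const card_ord mulr1.
have z1 : omega d s * (omega d t)^* - 1 != 0.
  rewrite subr_eq0; apply: contraNneq st => h; apply/eqP/omega_inj.
  by rewrite -[LHS]mulr1 -(omega_unit d t) [omega d t * _]mulrC mulrA h mul1r.
apply: (mulfI z1); rewrite -subrX1 exprMn -rmorphXn /= !omega_expd//.
by rewrite conjC1 mulr1 subrr !mulr0.
Qed.

(** * Powers of the phase operator in its eigenbasis *)

Section Basis.
Variables (d : nat) (e : 'I_d -> 'cV[C]_d).
Hypothesis ortho : orthonormal_family e.
Let V := phaseV e.

Lemma adj_mul_ortho s t : adj (e s) *m e t = ((s == t)%:R)%:M.
Proof. by rewrite [LHS]mx11_scalar ortho. Qed.

Lemma basis_complete : \sum_s e s *m adj (e s) = 1%:M.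
Proof.
pose E : 'M[C]_d := \matrix_(i, s) e s i 0.
have EE : adj E *m E = 1%:M.
  apply/matrixP => s t; have := ortho s t; rewrite !mxE => <-.
  by apply: eq_bigr => i _; rewrite !mxE.
rewrite -(mulmx1C EE); apply/matrixP => i j; rewrite summxE mxE.
by apply: eq_bigr => s _; rewrite !mxE big_ord1 !mxE.
Qed.

Lemma mulmx_basis_inj n (X Y : 'M[C]_(n, d)) : (forall s, X *m e s = Y *m e s) -> X = Y.
Proof.
move=> XY; rewrite -[X]mulmx1 -[Y]mulmx1 -basis_complete !mulmx_sumr.
by apply: eq_bigr => s _; rewrite !mulmxA XY.
Qed.

Lemma spectral_sum_mul (c : 'I_d -> C) t :
  (\sum_s c s *: (e s *m adj (e s))) *m e t = c t *: e t.
Proof.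
rewrite mulmx_suml (bigD1 t)//= big1 => [|s st].
  by rewrite -scalemxAl -mulmxA adj_mul_ortho eqxx mulmx1 addr0.
by rewrite -scalemxAl -mulmxA adj_mul_ortho (negPf st) mul_mx_scalar scale0r scaler0.
Qed.

Lemma phaseV_basis t : V *m e t = omega d t *: e t.
Proof. exact: spectral_sum_mul. Qed.

Lemma adj_phaseV_basis t : adj V *m e t = (omega d t)^* *: e t.
Proof.
rewrite adj_sum -(spectral_sum_mul (fun s => (omega d s)^*)); congr (_ *m _).
by apply: eq_bigr => s _; rewrite adjZ adjM adjK.
Qed.

Lemma phaseVX_basis j t : V ^+ j *m e t = omega d t ^+ j *: e t.
Proof.
elim: j => [|j IH]; first by rewrite !expr0 mul1mx scale1r.
by rewrite exprSr -mulmxA phaseV_basis -scalemxAr IH scalerA -exprS.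
Qed.

Lemma adj_phaseVX_basis j t : adj V ^+ j *m e t = (omega d t)^* ^+ j *: e t.
Proof.
elim: j => [|j IH]; first by rewrite !expr0 mul1mx scale1r.
by rewrite exprSr -mulmxA adj_phaseV_basis -scalemxAr IH scalerA -exprS.
Qed.

Lemma adj_phaseVX j : adj (V ^+ j) = adj V ^+ j.
Proof.
elim: j => [|j IH]; first by rewrite !expr0; exact: adj1.
by rewrite exprS exprSr -IH; exact: adjM.
Qed.

Lemma phaseVX_unitary j : adj (V ^+ j) *m V ^+ j = 1%:M.
Proof.
apply: mulmx_basis_inj => s; rewrite -mulmxA phaseVX_basis -scalemxAr adj_phaseVX.
by rewrite adj_phaseVX_basis scalerA -exprMn omega_unit expr1n scale1r mul1mx.
Qed.

Lemma phase_dampingE (lam : 'I_d -> R) X :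
  phase_damping e lam X = \sum_(j < d) (lam j)%:C *: (V ^+ j *m X *m adj (V ^+ j)).
Proof. by apply: eq_bigr => j _; rewrite adj_phaseVX. Qed.

Lemma phase_damping_state (lam : 'I_d -> R) X :
  (forall j, 0 <= lam j) -> \sum_(j < d) lam j = 1 ->
  is_state X -> is_state (phase_damping e lam X).
Proof.
move=> lam0 lam1 [Xp X1]; rewrite phase_dampingE; split.
  apply: psd_sum => // j; rewrite -[X in X *m _ *m _]adjK; exact: psd_congr.
rewrite raddf_sum -[RHS](rmorph1 (real_complex R)) -lam1 rmorph_sum; apply: eq_bigr => j _ /=.
by rewrite mxtraceZ -mulmxA mxtrace_mulC -mulmxA phaseVX_unitary mulmx1 X1 mulr1.
Qed.

Lemma basis_expand_ip (x y : 'cV[C]_d) :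
  adj x *m y = \sum_s (adj x *m e s) *m (adj (e s) *m y).
Proof.
rewrite -{1}[y]mul1mx -basis_complete mulmx_suml mulmx_sumr.
by apply: eq_bigr => s _; rewrite !mulmxA.
Qed.

Lemma flat_sqnorm (z : C) :
  `|z| = ((Num.sqrt (d%:R : R))^-1)%:C -> `|z| ^+ 2 = d%:R^-1.
Proof.
by move=> ->; rewrite -rmorphXn exprVn sqr_sqrtr ?ler0n// fmorphV rmorph_nat.
Qed.

(** Expanded in the basis [e], the inner product is a character sum weighted by the squared overlaps
    of [f]; flatness makes these weights constant. *)
Lemma phase_orbit_ortho (f : 'cV[C]_d) (j k : 'I_d) :
  (forall s, `|(adj f *m e s) 0 0| = ((Num.sqrt (d%:R : R))^-1)%:C) ->
  (adj (V ^+ j *m f) *m (V ^+ k *m f)) 0 0 = (j == k)%:R.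
Proof.
move=> flat; have d0 : (0 < d)%N := leq_trans (ltn0Sn _) (ltn_ord j).
rewrite basis_expand_ip summxE.
(* Index and exponent are exchanged here, so that the summation variable [s] becomes the exponent
   expected by [sum_omega]. *)
have adjfe i s : adj (V ^+ i *m f) *m e s = (omega d i)^* ^+ s *: (adj f *m e s).
  rewrite adjM -mulmxA adj_phaseVX adj_phaseVX_basis -scalemxAr; congr (_ *: _).
  by rewrite -!rmorphXn /= !omegaX mulnC.
have -> : \sum_s (adj (V ^+ j *m f) *m e s *m (adj (e s) *m (V ^+ k *m f))) 0 0
  = \sum_(s < d) d%:R^-1 * (omega d k ^+ s * (omega d j)^* ^+ s).
  apply: eq_bigr => s _.
  have -> : adj (e s) *m (V ^+ k *m f) = adj (adj (V ^+ k *m f) *m e s).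
    by rewrite adjM adjK.
  rewrite !adjfe adjZ rmorphXn /= conjCK -scalemxAl -scalemxAr mxE mxE mxE big_ord1.
  rewrite adjE -(flat_sqnorm (flat s)) normCK.
  ring.
rewrite -mulr_sumr sum_omega mulrA mulVf ?mul1r ?pnatr_eq0 -?lt0n//.
by rewrite eq_sym.
Qed.

(* The orbit [V^j f] of a flat vector is an orthonormal basis, in which the
   output of the channel is diagonal with entries [lam j]. *)
Lemma flat_output_entropy_le (lam : 'I_d -> R) (f : 'cV[C]_d) :
  (forall j, 0 <= lam j) ->
  (forall s, `|(adj f *m e s) 0 0| = ((Num.sqrt (d%:R : R))^-1)%:C) ->
  vN_entropy (phase_damping e lam (f *m adj f)) <= shannon lam.
Proof.
move=> lam0 flat.
pose F : 'M[C]_d := \matrix_(j, i) adj (V ^+ j *m f) 0 i.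
have FE n j (Y : 'M[C]_(d, n)) l : (F *m Y) j l = (adj (V ^+ j *m f) *m Y) 0 l.
  by rewrite !mxE; apply: eq_bigr => i _; rewrite !mxE.
have adjFE n j (Y : 'M[C]_(n, d)) l : (Y *m adj F) l j = (Y *m (V ^+ j *m f)) l 0.
  by rewrite !mxE; apply: eq_bigr => i _; rewrite !mxE conjCK.
have outer : phase_damping e lam (f *m adj f)
    = \sum_(j < d) (lam j)%:C *: ((V ^+ j *m f) *m adj (V ^+ j *m f)).
  rewrite phase_dampingE; apply: eq_bigr => j _.
  by rewrite [adj (V ^+ j *m f)]adjM !mulmxA.
apply: (@vN_entropy_le_diag R d _ F).
- by rewrite outer; apply: psd_sum => // j; exact: psd_outer.
- by apply/matrixP => j k; rewrite adjFE FE phase_orbit_ortho// mxE.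
- move=> l; rewrite adjFE -mulmxA FE outer mulmx_suml mulmx_sumr summxE.
  have E k : (adj (V ^+ l *m f) *m ((lam k)%:C *: (V ^+ k *m f *m adj (V ^+ k *m f))
      *m (V ^+ l *m f))) 0 0 = (lam k)%:C * ((l == k)%:R * (k == l)%:R).
    rewrite -scalemxAl -scalemxAr mxE outer_sandwich.
    by rewrite !(phase_orbit_ortho _ _ flat).
  rewrite (bigD1 l)//= big1 => [|k kl].
    by rewrite E eqxx !mulr1 addr0.
  by rewrite E (negPf kl) !mulr0.
Qed.

End Basis.
End Phases.

(** * Channels *)

Section Channels.
Variable R : realType.
Local Notation C := R[i].

Lemma channel_psd m (Om : 'M[C]_m -> 'M[C]_m) X :
  is_channel Om -> psd X -> psd (Om X).
Proof.
move=> [Ol [Op _]] Xp.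
(* Complete positivity is used with a one-dimensional ancilla, [X] being the only block of [Y]. *)
pose Y : 'M[C]_(1 * m) := blk_inj m (ord0 : 'I_1) *m X *m adj (blk_inj m (ord0 : 'I_1)).
have Yp : psd Y by rewrite /Y -[X in X *m _ *m _]adjK; exact: psd_congr.
have YX : block Y ord0 ord0 = X.
  rewrite blockE /Y !mulmxA blk_inj_ortho eqxx mul1mx.
  by rewrite -mulmxA blk_inj_ortho eqxx mulmx1.
rewrite -YX -block_tensmap_id // blockE; apply: psd_congr; exact: Op.
Qed.

Lemma channel_state m (Om : 'M[C]_m -> 'M[C]_m) X :
  is_channel Om -> is_state X -> is_state (Om X).
Proof.
move=> Oc [Xp X1]; split; first exact: channel_psd.
by have [_ [_ ->]] := Oc.
Qed.

Lemma tensmap_id_state d m (Om : 'M[C]_m -> 'M[C]_m) (X : 'M_(d * m)) :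
  is_channel Om -> is_state X -> is_state (tensmap id Om X).
Proof.
move=> [Ol [Op Ot]] [Xp X1]; split; first exact: Op.
rewrite -X1 !trace_block; apply: eq_bigr => i _.
by rewrite block_tensmap_id// Ot.
Qed.

Lemma Hmin_le n k (Psi : 'M[C]_n -> 'M[C]_n) (s : 'M[C]_n)
    (p : 'I_k -> R) (t : 'I_k -> 'M[C]_n) :
  (forall X, is_state X -> is_state (Psi X)) ->
  (forall j, 0 <= p j) -> \sum_j p j = 1 -> (forall j, is_state (t j)) ->
  s = \sum_j (p j)%:C *: t j ->
  Hmin Psi s <= \sum_j p j * vN_entropy (Psi (t j)).
Proof.
move=> PsiS p0 p1 ts sE; apply: ge_inf; last by exists k, p, t.
(* An infimum lies below a member of a set bounded below; nonnegativity of the entropy supplies the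
   bound 0. *)
exists 0 => x /= [k' [p' [t' [p'0 _ t's _ ->]]]].
by apply: sumr_ge0 => j _; rewrite mulr_ge0// vN_entropy_ge0//; exact: PsiS.
Qed.

Lemma xlogx_div (x c : R) : 0 <= x -> 0 < c ->
  xlogx (x / c) = (xlogx x - x * ln c) / c.
Proof.
move=> x0 c0; rewrite !xlogxM_ln.
have [->|xn0] := eqVneq x 0; first by rewrite !mul0r subrr mul0r.
by rewrite ln_div ?posrE// ?lt0r ?xn0// -mulrBr mulrAC.
Qed.

(** * Measurement in the basis [e] and the entropy bound *)

Section PhaseDamping.
Variables (d m : nat) (e : 'I_d -> 'cV[C]_d) (lam : 'I_d -> R).
Variables (rho : 'M[C]_(d * m)) (Om : 'M[C]_m -> 'M[C]_m).
Hypothesis ortho : orthonormal_family e.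
Hypotheses (lam0 : forall j, 0 <= lam j) (lam1 : \sum_(j < d) lam j = 1).
Hypotheses (rho_state : is_state rho) (Om_channel : is_channel Om).

Lemma dim_gt0 : (0 < d)%N.
Proof.
rewrite lt0n; apply/eqP => d0; have := oner_neq0 R.
rewrite -lam1 big1 ?eqxx// => j _.
by have := ltn_ord j; rewrite [X in (_ < X)%N]d0 ltn0.
Qed.

Lemma sum_slice_basis (X : 'M[C]_(d * m)) :
  \sum_s slice (e s) (e s) X = ptrace1 X.
Proof.
rewrite ptrace1E.
under eq_bigr do rewrite sliceE.
rewrite exchange_big; apply: eq_bigr => i _ /=; rewrite exchange_big /=.
have E j : \sum_s ((e s i 0)^* * e s j 0) *: block X i j = ((j == i)%:R : C) *: block X i j.
  rewrite -scaler_suml; congr (_ *: _).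
  have /matrixP/(_ j i) := basis_complete ortho.
  rewrite summxE mxE => <-; apply: eq_bigr => s _.
  by rewrite mxE big_ord1 adjE mulrC.
under eq_bigr do rewrite E.
rewrite (bigD1 i)//= big1 => [|j ji]; first by rewrite eqxx scale1r addr0.
by rewrite (negPf ji) scale0r.
Qed.

Let V := phaseV e.
Let sig0 := tensmap id Om rho.
Let sig (j : 'I_d) := kron (V ^+ j) 1%:M *m sig0 *m adj (kron (V ^+ j) 1%:M).

(** The slices with [s = t] do not depend on [j]; the others carry a nontrivial character, which
    uniform averaging over [j] kills. *)
Lemma slice_sig j s t :
  slice (e s) (e t) (sig j)
    = (omega R d s ^+ j * (omega R d t)^* ^+ j) *: slice (e s) (e t) sig0.
Proof.
rewrite slice_kron adj_phaseVX !adj_phaseVX_basis// sliceZ rmorphXn /= conjCK.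
by [].
Qed.

Lemma sig_state j : is_state (sig j).
Proof.
have [sp s1] := tensmap_id_state Om_channel rho_state.
split; first by rewrite /sig -[X in X *m _ *m _]adjK; exact: psd_congr.
rewrite /sig -mulmxA mxtrace_mulC -mulmxA adj_kron kronM phaseVX_unitary//.
by rewrite adj1 mulmx1 kron11 mulmx1.
Qed.

Section LocalBasis.
Variable U : 'I_d -> 'M[C]_m.
(** The controlled operator [sum_s |s><e_s| (x) U_s]: a change to the basis [e] on the first factor,
    followed by a basis of the second one depending on the outcome. *)
Definition local_basis : 'M[C]_(d * m) :=
  \sum_s blk_inj m s *m U s *m adj (ten m (e s)).

Lemma block_local_basis X s t :
  block (local_basis *m X *m adj local_basis) s t
    = U s *m slice (e s) (e t) X *m adj (U t).
Proof.
have E u : adj (blk_inj m u) *m local_basis = U u *m adj (ten m (e u)).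
  rewrite mulmx_sumr (bigD1 u)//= big1 => [|v vu].
    by rewrite !mulmxA blk_inj_ortho eqxx mul1mx addr0.
  by rewrite !mulmxA blk_inj_ortho eq_sym (negPf vu) mul_scalar_mx scale0r !mul0mx.
rewrite blockE -[X in _ *m X = _]adjK !mulmxA E -!mulmxA -adjM E adjM adjK.
by rewrite /slice !mulmxA.
Qed.

Lemma local_basis_unitary : (forall s, U s *m adj (U s) = 1%:M) ->
  local_basis *m adj local_basis = 1%:M.
Proof.
move=> UU; apply: block_inj => s t.
rewrite -[X in X *m adj _]mulmx1 block_local_basis /slice mulmx1 adj_ten_mul ortho.
rewrite blockE mulmx1 blk_inj_ortho mul_mx_scalar -scalemxAl.
have [->|_] := eqVneq s t; first by rewrite UU scale_scalar_mx mulr1.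
by rewrite !scale0r raddf0.
Qed.

End LocalBasis.

Hypothesis diag : forall s, (adj (e s) *m ptrace2 rho *m e s) 0 0 = (d%:R^-1 : R)%:C.

(* The state of the second factor conditional on outcome [s] of a measurement
   of the first one in the basis [e]. *)
Let tau s := (d%:R : R)%:C *: slice (e s) (e s) rho.

Lemma tau_state s : is_state (tau s).
Proof.
split.
  move=> x; rewrite -scalemxAr -scalemxAl mxE mulr_ge0 ?lecR//.
  by have [rp _] := rho_state; exact: psd_congr.
rewrite mxtraceZ trace_slice diag -rmorphM divff ?rmorph1//.
by rewrite pnatr_eq0 -lt0n dim_gt0.
Qed.

Lemma ptrace1_tau : ptrace1 rho = \sum_(s < d) (d%:R^-1 : R)%:C *: tau s.
Proof.
rewrite -sum_slice_basis; apply: eq_bigr => s _.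
by rewrite scalerA -rmorphM mulVf ?scale1r// pnatr_eq0 -lt0n dim_gt0.
Qed.

Lemma slice_sig0 s : slice (e s) (e s) sig0 = (d%:R^-1 : R)%:C *: Om (tau s).
Proof.
have [Ol _] := Om_channel.
rewrite slice_tensmap_id//.
have OZ c X : Om (c *: X) = c *: Om X.
  have O0 : Om 0 = 0.
    have := @linear_mx_sum R m Om nat [::] xpredT (fun=> 0) (fun=> 0) Ol.
    by rewrite !big_nil.
  by have := Ol c X 0; rewrite !addr0 O0 addr0.
by rewrite OZ scalerA -rmorphM mulVf ?scale1r// pnatr_eq0 -lt0n dim_gt0.
Qed.

(** Spectra of the conditional outputs. Divided by [d] and flattened over the pairs [(s, l)], they
    form the spectrum [b] of the uniform mixture. *)
Let beta s l := complex.Re (spectral_diag (Om (tau s)) 0 l).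
Let b (a : 'I_(d * m)) : R := mxvec (\matrix_(s, l) (beta s l / d%:R)) 0 a.

(** The case [mu = 1/d] of [vN_entropy_mixture_ge], in the basis where each conditional output is
    diagonal; the two occurrences of [ln d] cancel. *)
Lemma phase_damping_entropy_ge_avg :
  shannon lam + \sum_(s < d) d%:R^-1 * vN_entropy (Om (tau s))
    <= vN_entropy (tensmap (phase_damping e lam) Om rho).
Proof.
have d0 : 0 < d%:R :> R by rewrite ltr0n dim_gt0.
have Ot s : is_state (Om (tau s)) by apply: channel_state => //; exact: tau_state.
pose U s := spectralmx (Om (tau s)).
have Usp s : [/\ U s *m adj (U s) = 1%:M, adj (U s) *m U s = 1%:M,
    Om (tau s) = adj (U s) *m rdiag (beta s) *m U s & forall l, 0 <= beta s l].
  by have [Op _] := Ot s; exact: psd_spectral.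
have UOU s : U s *m Om (tau s) *m adj (U s) = rdiag (beta s).
  by have [UU _ -> _] := Usp s; rewrite !mulmxA UU mul1mx -mulmxA UU mulmx1.
have bE s l : b (mxvec_index s l) = beta s l / d%:R by rewrite /b mxvecE mxE.
pose V0 := local_basis U.
have V0V0 : V0 *m adj V0 = 1%:M.
  by apply: local_basis_unitary => s; have [] := Usp s.
have A_eq : tensmap (phase_damping e lam) Om rho = \sum_j (lam j)%:C *: sig j.
  by apply: tensmap_kraus => Y; exact: phase_dampingE.
have := @vN_entropy_mixture_ge R _ _ sig lam (fun=> d%:R^-1) V0 b.
rewrite -A_eq => /(_ (fun j => (sig_state j).1) (fun j => (sig_state j).2) lam0).
have sumc (c : 'I_d -> R) s t : slice (e s) (e t) (\sum_j (c j)%:C *: sig j)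
    = (\sum_(j < d) (c j)%:C * (omega R d s ^+ j * (omega R d t)^* ^+ j))
      *: slice (e s) (e t) sig0.
  by rewrite slice_sum scaler_suml; apply: eq_bigr => j _; rewrite slice_sig scalerA.
move=> /(_ _ V0V0 _ _) H; apply: le_trans (H _ _ _).
(* Chain rule for the entropy: a uniform outcome, then the spectrum of the conditional output. *)
- have -> : shannon b = ln d%:R + \sum_(s < d) d%:R^-1 * vN_entropy (Om (tau s)).
    rewrite /shannon sum_mxvec -sumrN.
    have -> : ln d%:R = \sum_(s < d) d%:R^-1 * ln d%:R :> R.
      by rewrite sumr_const card_ord -mulrnAl -[_^-1 *+ _]mulr_natl mulfV ?mul1r// gt_eqF.
    rewrite -big_split; apply: eq_bigr => s _ /=.
    have [_ _ _ be0] := Usp s.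
    under eq_bigr => l _ do rewrite bE xlogx_div//.
    have be1 : \sum_l beta s l = 1.
      have [Op O1] := Ot s; apply: (@complexI R).
      by rewrite psd_trace_re.
    rewrite -mulr_suml sumrB -mulr_suml be1 mul1r /vN_entropy -/beta.
    by rewrite mulrC -mulrN opprB mulrBr mulrN.
  rewrite -mulr_suml lam1 mul1r lnV ?posrE// /shannon.
  by rewrite le_eqVlt; apply/orP; left; apply/eqP; ring.
- by move=> j; rewrite invr_gt0.
(* Uniform weights: the character sum removes the off-diagonal blocks, and [U s] diagonalizes the
   others. *)
- apply: block_inj => s t; rewrite block_local_basis sumc.
  rewrite -mulr_sumr sum_omega fmorphV rmorph_nat mulKf ?pnatr_eq0 -?lt0n ?dim_gt0//.
  have [<-|st] := eqVneq s t.
    rewrite scale1r slice_sig0 -scalemxAr -scalemxAl UOU.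
    apply/matrixP => k l; rewrite !mxE mxvec_index_eq eqxx /= bE.
    by rewrite mulrnAr [in RHS]mulrC [in RHS]rmorphM.
  rewrite scale0r mulmx0 mul0mx; apply/matrixP => k l.
  by rewrite !mxE mxvec_index_eq (negPf st).
(* Weights [lam]: only diagonal blocks matter, where the phases cancel and the weights add up to
   1. *)
- move=> a; case/mxvec_indexP: a => s l.
  transitivity ((block (V0 *m tensmap (phase_damping e lam) Om rho *m adj V0) s s) l l).
    by rewrite [RHS]mxE.
  rewrite block_local_basis A_eq sumc.
  under eq_bigr do rewrite -exprMn omega_unit expr1n mulr1.
  rewrite -rmorph_sum lam1 scale1r slice_sig0 -scalemxAr -scalemxAl UOU bE.
  by rewrite !mxE eqxx mulrC rmorphM.
Qed.

(** The conditional states [tau s] with equal weights form an admissible ensemble for the second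
    marginal. *)
Lemma Hmin_le_avg :
  Hmin Om (ptrace1 rho) <= \sum_(s < d) d%:R^-1 * vN_entropy (Om (tau s)).
Proof.
apply: Hmin_le.
- by move=> X; exact: channel_state.
- by move=> _; rewrite invr_ge0.
- by rewrite sumr_const card_ord -[_^-1 *+ _]mulr_natl mulfV// pnatr_eq0 -lt0n dim_gt0.
- exact: tau_state.
- exact: ptrace1_tau.
Qed.

End PhaseDamping.

(** Each flat component gives every outcome probability [1/d], and a convex combination preserves
    this. *)
Lemma setA_diag d (e : 'I_d -> 'cV[C]_d) (s : 'M[C]_d) t :
  setA e s -> (adj (e t) *m s *m e t) 0 0 = (d%:R^-1 : R)%:C.
Proof.
move=> [k [p [f [p0 p1 _ flat ->]]]].
have -> : (d%:R^-1 : R)%:C = \sum_j (p j)%:C * (d%:R^-1 : R)%:C.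
  by rewrite -mulr_suml -rmorph_sum p1 mul1r.
rewrite mulmx_sumr mulmx_suml summxE; apply: eq_bigr => j _ /=.
rewrite -scalemxAr -scalemxAl mxE -mulmxA outer_sandwich.
have -> : (adj (e t) *m f j) 0 0 = ((adj (f j) *m e t) 0 0)^*.
  by rewrite -adjE adjM adjK.
by rewrite [X in _ * X = _]mulrC -normCK (flat_sqnorm (flat j t)) fmorphV rmorph_nat.
Qed.

(** The decomposition witnessing [setA] competes in the infimum, and each of its flat pure states
    has output entropy at most that of [lam]. *)
Lemma Hmin_setA_le d (e : 'I_d -> 'cV[C]_d) (lam : 'I_d -> R) (s : 'M[C]_d) :
  orthonormal_family e -> (forall j, 0 <= lam j) -> \sum_(j < d) lam j = 1 ->
  setA e s -> Hmin (phase_damping e lam) s <= shannon lam.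
Proof.
move=> ortho lam0 lam1 [k [p [f [p0 p1 f1 flat sE]]]].
rewrite -[leRHS]mul1r -p1 mulr_suml.
apply: le_trans (ler_sum _ (fun j _ => ler_wpM2l (p0 j)
  (flat_output_entropy_le ortho lam0 (flat j)))).
apply: Hmin_le => // [X|j]; first exact: phase_damping_state.
split; first exact: psd_outer.
by rewrite mxtrace_mulC /mxtrace big_ord1.
Qed.

End Channels.

Theorem theorem2 (R : realType) (d m : nat)
  (e : 'I_d -> 'cV[R[i]]_d) (lam : 'I_d -> R)
  (rho : 'M[R[i]]_(d * m)) (Om : 'M[R[i]]_m -> 'M[R[i]]_m) :
  orthonormal_family e ->
  (forall j, 0 <= lam j) -> \sum_(j < d) lam j = 1 ->
  is_state rho ->
  setA e (ptrace2 rho) ->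
  is_channel Om ->
  vN_entropy (tensmap (phase_damping e lam) Om rho)
    >= shannon lam + Hmin Om (ptrace1 rho)
  /\ shannon lam + Hmin Om (ptrace1 rho)
    >= Hmin (phase_damping e lam) (ptrace2 rho) + Hmin Om (ptrace1 rho).
Proof.
move=> ortho lam0 lam1 rhoS rhoA OmC; split; last first.
  by rewrite lerD2r; exact: Hmin_setA_le.
have diag s := setA_diag s rhoA.
apply: le_trans (phase_damping_entropy_ge_avg ortho lam0 lam1 rhoS OmC diag).
by rewrite lerD2l; exact: (Hmin_le_avg ortho lam1 rhoS OmC diag).
Qed.
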